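(* Fix $\mathbf n=(n_i)_{i\in[k]}$ with $n_1\le n_2\le\cdots\le n_k$. Then there exists a universal constant $c>0$ (not depending on $k$ or $\mathbf n$) such that $$\inf_{\mathcal A}\ \sup_{\theta\in\Theta_{\mathbf n}}\mathcal R(\mathcal A,\theta)\ \ge\ c\max_{m\in[k]}\sqrt{\frac{\max(1,\log m)}{n_m}},$$ where the infimum is over all (possibly randomized) algorithms.
   Context: Batch bandit setting: there are $k>0$ arms, $[k]=\{1,\dots,k\}$. For each arm $i$ there are $n_i>0$ i.i.d. real-valued observations $X_{i,1},\dots,X_{i,n_i}\sim P_i$, and all observations $X=(X_{i,j})_{i\in[k],j\in[n_i]}$ are independent. An instance is $\theta=((n_i)_{i\in[k]},(P_i)_{i\in[k]})$, where each $P_i$ is 1-subgaussian (that is, $\mathbb E_{Y\sim P_i}[e^{\lambda(Y-\mu_i)}]\le e^{\lambda^2/2}$ for all $\lambda\in\mathbb R$) with mean $\mu_i\in[0,1]$. $\Theta_{\mathbf n}$ is the set of all such instances with counts $\mathbf n$ fixed. An algorithm $\mathcal A$ takes the counts and the data $X$ and returns a (possibly randomized) arm $\mathcal A(X)\in[k]$. With $\mu^*=\max_i\mu_i$, its simple regret is $\mathcal R(\mathcal A,\theta)=\mu^*-\mathbb E_{X\sim\theta}[\mu_{\mathcal A(X)}]$, the expectation being over the data and the algorithm's randomness.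
   Formalization: Stated for k ≥ 2 arms and with the maximum on the right capped at 1, i.e. the bound is c·min(1, max_m sqrt(max(1, log m)/n_m)); as printed the claim fails for k = 1 (regret is 0) and for all n_i = 1 with k large (regret is at most 1). *)

(* Defs.v *)
From HB Require Import structures.
From mathcomp Require Import all_boot all_order all_algebra.
From mathcomp Require Import all_classical all_reals all_analysis.

Set Implicit Arguments.
Unset Strict Implicit.
Unset Printing Implicit Defensive.

Import Order.TTheory GRing.Theory Num.Theory.
Import numFieldNormedType.Exports.

Local Open Scope classical_set_scope.
Local Open Scope ring_scope.

Section product_law.
Context {R : realType}.
Local Notation borelR := (measurableTypeR R).

Definition tcons N (z : borelR * N.-tuple borelR) : N.+1.-tuple borelR :=
  [tuple of z.1 :: z.2].

Lemma measurable_tcons N : measurable_fun [set: borelR * N.-tuple borelR] (@tcons N).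
Proof. exact: (measurable_cons measurable_fst measurable_snd). Qed.

HB.instance Definition _ N :=
  isMeasurableFun.Build _ _ _ _ (@tcons N) (@measurable_tcons N).

(* The product of the N laws Q 0, ..., Q (N-1); see tuple_lawE. *)
Fixpoint tuple_law N : ('I_N -> probability borelR R) ->
    probability (N.-tuple borelR) R :=
  match N with
  | 0 => fun=> \d_([tuple] : 0.-tuple borelR)
  | N'.+1 => fun Q =>
      distribution (Q ord0 \x tuple_law (fun l => Q (lift ord0 l)))%E (@tcons N')
  end.

Lemma tuple_lawE N (Q : 'I_N -> probability borelR R) (B : 'I_N -> set borelR) :
  (forall l, measurable (B l)) ->
  tuple_law Q [set x | forall l, B l (tnth x l)] = (\prod_(l < N) Q l (B l))%E.
Proof.
elim: N Q B => [|N IH] Q B mB.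
  rewrite big_ord0 /= diracE mem_set//=.
  by case.
rewrite big_ord_recl -IH; last by move=> l; exact: mB.
rewrite /= /distribution /pushforward -product_measure1E//; first last.
  rewrite (_ : [set x | _] =
    \bigcap_(l : 'I_N) ((@tnth N borelR)^~ l @^-1` B (lift ord0 l))); last first.
    by apply/seteqP; split => x /= h l //; [move=> _; exact: h|exact: (h l I)].
  apply: fin_bigcap_measurable; first exact: finite_finset.
  by move=> l _; rewrite -[X in measurable X]setTI; exact: measurable_tnth.
congr (_ _); apply/seteqP; split => [[a x] /= h|[a x] /= [h0 h] l].
  by split=> [|l]; [have := h ord0|have := h (lift ord0 l); rewrite tnthS].
by case: (unliftP ord0 l) => [j ->|->] //; rewrite tnthS.
Qed.

End product_law.

Section batch_bandit.
Context {R : realType}.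
Local Notation borelR := (measurableTypeR R).
Variable k : nat.

(* Arms are 0-based: i : 'I_k is the (i+1)-st arm.  The indices (i, j) of the
   observations X_(i,j) are enumerated, so that a data set is a tuple. *)
Definition obs_index (n : 'I_k -> nat) := {i : 'I_k & 'I_(n i)}.

Definition data (n : 'I_k -> nat) := #|{: obs_index n}|.-tuple borelR.

Definition obs n (x : data n) (i : 'I_k) (j : 'I_(n i)) : R :=
  tnth x (enum_rank (Tagged (fun i => 'I_(n i)) j : obs_index n)).

Definition data_law n (P : 'I_k -> probability borelR R) :
    probability (data n) R :=
  tuple_law (fun l => P (tag (enum_val l : obs_index n))).

(* data_law is the joint law of independent X_(i,j) ~ P_i. *)
Lemma data_lawE n (P : 'I_k -> probability borelR R)
    (B : forall i : 'I_k, 'I_(n i) -> set borelR) :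
  (forall i j, measurable (B i j)) ->
  data_law n P [set x : data n | forall i j, B i j (obs x j)] =
  (\prod_(i < k) \prod_(j < n i) P i (B i j))%E.
Proof.
move=> mB.
pose B' (u : obs_index n) := B (tag u) (tagged u).
have -> : [set x : data n | forall i j, B i j (obs x j)] =
    [set x | forall l, B' (enum_val l) (tnth x l)].
  apply/seteqP; split => x /= h.
    move=> l; rewrite /B'; have := h (tag (enum_val l)) (tagged (enum_val l)).
    by rewrite /obs taggedK enum_valK.
  move=> i j; have := h (enum_rank (Tagged (fun i => 'I_(n i)) j : obs_index n)).
  by rewrite enum_rankK.
rewrite /data_law (@tuple_lawE _ _ _ (fun l => B' (enum_val l))); last first.
  by move=> l; exact: mB.
rewrite (@sig_big_dep _ _ _ _ (fun i => 'I_(n i)) predT (fun _ => predT)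
  (fun i j => P i (B i j))) /=.
rewrite [RHS](reindex (@enum_val (obs_index n) predT)) //=.
exact/onW_bij/enum_val_bij.
Qed.

Definition mean (P : probability borelR R) : R := fine ('E_P[(id : R -> R)])%E.

Definition subgaussian1 (P : probability borelR R) : Prop :=
  P.-integrable setT (EFin : borelR -> \bar R) /\
  forall lam : R,
    ('M_P (fun y : borelR => (y : R) - mean P)%R lam <= (expR (lam ^+ 2 / 2))%:E)%E.

(* The counts are a separate parameter of the regret, so an element of
   Theta_n is given by its arm laws. *)
Definition Theta : set ('I_k -> probability borelR R) :=
  [set P | forall i, subgaussian1 (P i) /\ 0 <= mean (P i) <= 1].

(* A randomized algorithm is a Markov kernel from the data to the finite set
   of arms, given by its probability mass functions. *)
Record algorithm (n : 'I_k -> nat) := Algorithm {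
  play : data n -> 'I_k -> R ;
  play_ge0 : forall x i, 0 <= play x i ;
  play_sum1 : forall x, \sum_(i < k) play x i = 1 ;
  measurable_play : forall i, measurable_fun [set: data n] (fun x => play x i) }.

(* Means of instances in Theta are nonnegative, so the default value 0 of the
   maximum plays no role when 0 < k. *)
Definition best_mean (P : 'I_k -> probability borelR R) : R :=
  \big[Num.max/0]_(i < k) mean (P i).

Definition regret n (A : algorithm n) (P : 'I_k -> probability borelR R) : \bar R :=
  ((best_mean P)%:E -
   'E_(data_law n P)[fun x => (\sum_(i < k) play A x i * mean (P i))%R])%E.

Definition minimax_regret (n : 'I_k -> nat) : \bar R :=
  ereal_inf [set ereal_sup [set regret A P | P in Theta] | A in [set: algorithm n]].

End batch_bandit.

(* Main.v *)
Require Import Defs.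
From HB Require Import structures.
From mathcomp Require Import all_boot all_order all_algebra.
From mathcomp Require Import all_classical all_reals all_analysis.
From mathcomp Require Import measurable_realfun ring lra.

(* All instances give each arm a two-point law, i.e. a biased coin.  For a
   single arm i, raising its bias from 1/2 to 1/2 + e multiplies the chi-square
   factor of the data law by at most exp (4 e^2 n_i), so by Cauchy-Schwarz
   P'(A = i)^2 <= exp (4 e^2 n_i) P(A = i).
   - If log m <= 1, let the other arms have bias 1/2 + e and the first arm
     either 1/2 or 1/2 + 2 e: with e^2 n_1 small enough no algorithm has small
     regret on both instances.
   - If log m >= 1, start from the instance where all biases are 1/2.  One of
     the first m arms is played with probability at most 1/m, and for
     e^2 n_m a small multiple of log m raising its bias by e leaves it
     unlikely to be played. *)

Set Implicit Arguments.
Unset Strict Implicit.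
Unset Printing Implicit Defensive.
Import Order.TTheory GRing.Theory Num.Theory.
Local Open Scope classical_set_scope.
Local Open Scope ring_scope.

(** * Two-point laws: integrals and subgaussianity *)

Section coin.
Context {R : realType}.
Local Notation borelR := (measurableTypeR R).
Implicit Types p u : R.

(* Any value in (0, 1] would do; 1/2 leaves room for crude bounds on [expR] in
   the proof of subgaussianity. *)
Definition coin_val (b : bool) : borelR := if b then 2^-1 else 0.

Lemma measurable_coin_val : measurable_fun [set: bool] coin_val.
Proof. by []. Qed.

HB.instance Definition _ :=
  isMeasurableFun.Build _ _ _ _ coin_val measurable_coin_val.

Definition coin_law p : probability borelR R :=
  distribution (bernoulli_prob p) coin_val.

Lemma ge0_integral_coin_law p (f : borelR -> \bar R) : 0 <= p <= 1 ->
  measurable_fun [set: borelR] f -> (forall y, (0 <= f y)%E) ->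
  (\int[coin_law p]_y f y = p%:E * f (2^-1)%R + (1 - p)%:E * f 0%R)%E.
Proof.
move=> p01 mf f0.
by rewrite ge0_integral_distribution//= integral_bernoulli_prob//=.
Qed.

Lemma integral_coin_law p (f : borelR -> R) : 0 <= p <= 1 ->
  measurable_fun [set: borelR] f ->
  (\int[coin_law p]_y (f y)%:E = (p * f (2^-1) + (1 - p) * f 0)%R%:E)%E.
Proof.
move=> p01 mf.
have mEf : measurable_fun [set: borelR] (EFin \o f) by exact/measurable_EFinP.
rewrite integralE !ge0_integral_coin_law//; last 2 first.
- exact: measurable_funeneg.
- exact: measurable_funepos.
rewrite !funeposE !funenegE /= -!EFin_max -!EFinM -!EFinD.
have maxB (a : R) : Num.max a 0 - Num.max (- a) 0 = a.
  by case: leP => ?; case: leP => ?; lra.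
rewrite -[in RHS](maxB (f 2^-1)) -[in RHS](maxB (f 0)); congr EFin; ring.
Qed.

Lemma integrable_coin_law p (f : borelR -> R) : 0 <= p <= 1 ->
  measurable_fun [set: borelR] f ->
  (coin_law p).-integrable [set: borelR] (EFin \o f).
Proof.
move=> p01 mf; apply/integrableP; split; first exact/measurable_EFinP.
rewrite (integral_coin_law (f := fun y => `|f y|)) ?ltry//.
exact: measurableT_comp.
Qed.

Lemma coin_law_mean p : 0 <= p <= 1 -> mean (coin_law p) = p / 2.
Proof.
move=> p01; rewrite /mean unlock.
by rewrite (integral_coin_law (f := fun y => y))//= mulr0 addr0.
Qed.

(** Convexity of the exponential: its tangent at [p * u] bounds its values at [0] and [u] from
    below, and these two bounds average to [expR (p * u)]. *)
Lemma expR_tangent p u : 0 <= p <= 1 ->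
  expR (p * u) <= 1 - p + p * expR u.
Proof.
move=> /andP[p0 p1].
have h0 : 1 - p * u <= expR (- (p * u)) by exact: expR_ge1Dx.
have h1 : 1 + (u - p * u) <= expR (u - p * u) by exact: expR_ge1Dx.
have -> : 1 - p + p * expR u =
    expR (p * u) * ((1 - p) * expR (- (p * u)) + p * expR (u - p * u)).
  rewrite expRD !expRN; field; exact: lt0r_neq0 (expR_gt0 _).
rewrite ler_peMr ?expR_ge0//; nra.
Qed.

Lemma expR_le_inv u : u < 1 -> expR u <= (1 - u)^-1.
Proof.
move=> u1; rewrite -[leLHS]invrK -expRN lef_pV2 ?posrE ?expR_gt0 ?subr_gt0//.
exact: expR_ge1Dx.
Qed.

(** The left side is the squared hyperbolic cosine of [u / 2], hence at most [expR (u ^+ 2 / 4)];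
    the larger exponent leaves room for elementary bounds. *)
Lemma expR_cosh_le u : (2 + expR u + expR (- u)) / 4 <= expR (2 * u ^+ 2).
Proof.
wlog u0 : u / 0 <= u.
  move=> h; have [/h//|/ltW u0] := leP 0 u.
  have := h (- u); rewrite oppr_ge0 sqrrN opprK => /(_ u0).
  by rewrite -addrA (addrC (expR (- u))) addrA.
(* For [u] above 1/2, [2 * u ^+ 2] exceeds [u] and the left side is at most [expR u]. Below,
   geometric bounds give at most [1 + 2 * u ^+ 2]. *)
have [u_le|u_gt] := leP u 2^-1; last first.
  apply: (@le_trans _ _ (expR u)); last by rewrite ler_expR; nra.
  have : expR (- u) <= 1 by rewrite expR_le1 oppr_le0.
  have : 1 <= expR u by rewrite -[leLHS]expR0 ler_expR.
  lra.
apply: (le_trans _ (expR_ge1Dx _)).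
have e1 : expR u <= (1 - u)^-1 by apply: expR_le_inv; lra.
have e2 : expR (- u) <= (1 + u)^-1.
  by rewrite -{2}[u]opprK; apply: expR_le_inv; lra.
have e3 : (1 - u)^-1 + (1 + u)^-1 <= 2 + 8 * u ^+ 2.
  have -> : (1 - u)^-1 + (1 + u)^-1 = 2 / (1 - u ^+ 2).
    by field; apply/and3P; split; apply: lt0r_neq0; nra.
  have : 0 <= u ^+ 2 <= 4^-1 by apply/andP; split; [exact: sqr_ge0|nra].
  by move: (u ^+ 2) => v v4; rewrite ler_pdivrMr; nra.
lra.
Qed.

(** Symmetrization: by Jensen, the centered coin is dominated by the difference of two independent
    copies, whose moment generating function depends on [p] only through [p * (1 - p)], at most
    1/4. *)
Lemma coin_law_subgaussian p : 0 <= p <= 1 -> subgaussian1 (coin_law p).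
Proof.
move=> p01; split; first exact: (integrable_coin_law (f := fun y => y)).
move=> lam; rewrite /mmt_gen_fun unlock coin_law_mean//.
rewrite (integral_coin_law
  (f := fun y => expR ((y - p / 2) * lam)))//; last first.
  apply: measurableT_comp => //; apply: measurable_funM => //.
  exact: measurable_funB.
rewrite lee_fin.
set u := lam / 2.
have -> : lam ^+ 2 / 2 = 2 * u ^+ 2 by rewrite /u; field.
apply: le_trans (expR_cosh_le u).
have -> : (2^-1 - p / 2) * lam = u + p * - u by rewrite /u; field.
have -> : (0 - p / 2) * lam = p * - u by rewrite /u; field.
have := @expR_tangent p (- u) p01; rewrite expRD expRN.
set E := expR (p * - u); set X := expR u => hE.
have X0 : 0 < X by exact: expR_gt0.
have E0 : 0 < E by exact: expR_gt0.
have [p0 p1] := andP p01.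
have XX : X * X^-1 = 1 by rewrite divff// lt0r_neq0.
have X2 : 0 <= X + X^-1 - 2.
  have -> : X + X^-1 - 2 = (X - 1) ^+ 2 / X by field; apply: lt0r_neq0.
  by rewrite divr_ge0 ?sqr_ge0// ltW.
apply: (@le_trans _ _ ((1 - p + p * X^-1) * (1 - p + p * X))).
  apply: (@le_trans _ _ (E * (1 - p + p * X))); first by lra.
  by apply: ler_wpM2r => //; nra.
have -> : (1 - p + p * X^-1) * (1 - p + p * X) =
    1 + p * (1 - p) * (X + X^-1 - 2).
  have -> : (1 - p + p * X^-1) * (1 - p + p * X) =
    (1 - p)^+2 + p ^+ 2 * (X * X^-1) + p * (1 - p) * (X + X^-1) by ring.
  rewrite XX; ring.
have hp : p * (1 - p) <= 4^-1.
  by have := sqr_ge0 (p - 2^-1); rewrite sqrrB expr2; lra.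
by have := ler_wpM2r X2 hp; lra.
Qed.
End coin.

(** * Expectations under products of coins, and change of measure *)

Section coin_mean.
Context {R : realType}.
Local Notation borelR := (measurableTypeR R).

(** Expectation under a product of coin laws as an iterated two-point average, which makes linearity
    and monotonicity plain algebra. *)
Fixpoint coin_mean N : ('I_N -> R) -> (N.-tuple borelR -> R) -> R :=
  match N with
  | 0 => fun _ g => g [tuple]
  | N'.+1 => fun p g =>
      let m y :=
        coin_mean (fun l => p (lift ord0 l)) (fun x => g (tcons (y, x)))
      in p ord0 * m 2^-1 + (1 - p ord0) * m 0
  end.

(** Tonelli peels off the first coordinate. This is the bridge from measure theory to finite
    sums. *)
Lemma integral_tuple_coin_law N (p : 'I_N -> R) (g : N.-tuple borelR -> R) :
  (forall l, 0 <= p l <= 1) -> (forall x, 0 <= g x) ->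
  measurable_fun [set: N.-tuple borelR] g ->
  (\int[tuple_law (fun l => coin_law (p l))]_x (g x)%:E = (coin_mean p g)%:E)%E.
Proof.
elim: N p g => [|N IH] p g p01 g0 mg /=.
  rewrite integral_dirac//= ?diracT ?mul1e//.
  exact/measurable_EFinP.
have mEg : measurable_fun [set: N.+1.-tuple borelR] (EFin \o g).
  exact/measurable_EFinP.
have mEgt : measurable_fun [set: borelR * N.-tuple borelR]
    (EFin \o g \o @tcons R N).
  by apply: measurableT_comp => //; exact: measurable_tcons.
rewrite ge0_integral_distribution// fubini_tonelli1//=; last first.
  by move=> x; rewrite lee_fin.
rewrite -/(coin_law (p ord0)).
rewrite ge0_integral_coin_law//; last 2 first.
- by apply: measurable_fun_fubini_tonelli_F => // x; rewrite lee_fin.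
- by move=> y; apply: integral_ge0 => x _; rewrite lee_fin.
have mgt y : measurable_fun [set: N.-tuple borelR] (fun x => g (tcons (y, x))).
  apply: (measurable_fun_pair2 (f := g \o @tcons R N)).
  by apply: measurableT_comp => //; exact: measurable_tcons.
by rewrite /fubini_F/= !IH.
Qed.

Lemma coin_mean_cst N (p : 'I_N -> R) a :
  coin_mean p (fun _ : N.-tuple borelR => a) = a.
Proof. by elim: N p => [//|N IH] p /=; rewrite !IH; ring. Qed.

Lemma coin_mean_affine N (p : 'I_N -> R) a b (g : N.-tuple borelR -> R) :
  coin_mean p (fun x => a + b * g x) = a + b * coin_mean p g.
Proof. by elim: N p g => [//|N IH] p g /=; rewrite !IH; ring. Qed.

Lemma coin_mean_sum N (p : 'I_N -> R) I (r : seq I)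
    (g : I -> N.-tuple borelR -> R) :
  coin_mean p (fun x => \sum_(i <- r) g i x) = \sum_(i <- r) coin_mean p (g i).
Proof.
elim: N p g => [//|N IH] p g /=.
by rewrite !IH !mulr_sumr -big_split.
Qed.

Lemma ler_coin_mean N (p : 'I_N -> R) (f g : N.-tuple borelR -> R) :
  (forall l, 0 <= p l <= 1) -> (forall x, f x <= g x) ->
  coin_mean p f <= coin_mean p g.
Proof.
elim: N p f g => [|N IH] p f g p01 fg /=; first exact: fg.
have /andP[p0 p1] := p01 ord0.
by apply: lerD; apply: ler_wpM2l; rewrite ?subr_ge0//; exact: IH.
Qed.

(* Cauchy-Schwarz, one coordinate at a time: the factor [C l] dominates one
   plus the chi-square divergence of the [l]-th coins. *)
Lemma coin_mean_change N (p q C : 'I_N -> R) (g : N.-tuple borelR -> R) :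
  (forall l, 0 <= p l <= 1) -> (forall l, 0 < q l < 1) ->
  (forall l, p l ^+ 2 / q l + (1 - p l) ^+ 2 / (1 - q l) <= C l) ->
  coin_mean p g ^+ 2 <= (\prod_l C l) * coin_mean q (fun x => g x ^+ 2).
Proof.
elim: N p q C g => [|N IH] p q C g p01 q01 hC /=.
  by rewrite big_ord0 mul1r.
have /andP[p0 p1] := p01 ord0; have /andP[q0 q1] := q01 ord0.
rewrite big_ord_recl.
set D := \prod_l _.
have {}IH y := IH (fun l => p (lift ord0 l)) (fun l => q (lift ord0 l))
  (fun l => C (lift ord0 l)) (fun x => g (tcons (y, x)))
  (fun=> p01 _) (fun=> q01 _) (fun=> hC _).
have := IH 0; have := IH 2^-1; have := hC ord0.
rewrite -/D.
move: p0 p1 q0 q1; set P := p ord0; set Q := q ord0; set c := C ord0.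
(* [a] and [A] condition on first observation 1/2, [b] and [B] on first observation 0; the capitals
   average the square of [g] under [q]. *)
set a := coin_mean _ _; set A := coin_mean _ _.
set b := coin_mean _ _; set B := coin_mean _ _.
move=> p0 p1 q0 q1 hc ha hb.
have s0 : 0 <= Q * (D * A) + (1 - Q) * (D * B).
  rewrite addr_ge0// mulr_ge0 ?(le_trans _ ha) ?(le_trans _ hb) ?sqr_ge0//; lra.
apply: (@le_trans _ _ (c * (Q * (D * A) + (1 - Q) * (D * B)))); last first.
  rewrite le_eqVlt; apply/orP; left; apply/eqP; ring.
apply: le_trans (ler_wpM2r s0 hc).
have Q1 : 0 < 1 - Q by rewrite subr_gt0.
set e := P ^+ 2 / Q + (1 - P) ^+ 2 / (1 - Q).
apply: (@le_trans _ _ (e * (Q * a ^+ 2 + (1 - Q) * b ^+ 2))); last first.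
  apply: ler_wpM2l; last by apply: lerD; apply: ler_wpM2l => //; exact: ltW.
  by rewrite addr_ge0// divr_ge0 ?sqr_ge0// ltW.
(* Lagrange's identity: the gap in the two-term Cauchy-Schwarz inequality is a square over
   [Q * (1 - Q)]. *)
rewrite -subr_ge0.
have -> : e * (Q * a ^+ 2 + (1 - Q) * b ^+ 2) - (P * a + (1 - P) * b) ^+ 2 =
  (P * (1 - Q) * b - (1 - P) * Q * a) ^+ 2 / (Q * (1 - Q)).
  by rewrite /e; field; rewrite !lt0r_neq0.
by rewrite divr_ge0 ?sqr_ge0// mulr_ge0// ltW.
Qed.
End coin_mean.

(** * Regret and play probabilities when one arm has its own bias *)

Section coin_bandit.
Context {R : realType} (k : nat) (n : 'I_k -> nat).
Local Notation borelR := (measurableTypeR R).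
Implicit Types (A : algorithm (R := R) n) (p q e : R) (i j : 'I_k).

Definition spike p q i j : R := if j == i then q else p.

Definition spike_instance p q i j : probability borelR R :=
  coin_law (spike p q i j).

Definition obs_arm (l : 'I_#|{: obs_index n}|) : 'I_k := tag (enum_val l).

Definition play_prob A (a : 'I_k -> R) i : R :=
  coin_mean (a \o obs_arm) (play A ^~ i).

Lemma play_prob_ge0 A (a : 'I_k -> R) i : (forall j, 0 <= a j <= 1) ->
  0 <= play_prob A a i.
Proof.
move=> a01; rewrite -(coin_mean_cst (a \o obs_arm) 0).
by apply: ler_coin_mean => [l|x]; [exact: a01|exact: play_ge0].
Qed.

Lemma sum_play_prob A (a : 'I_k -> R) : \sum_i play_prob A a i = 1.
Proof.
rewrite -coin_mean_sum -[RHS](coin_mean_cst (a \o obs_arm)).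
by congr coin_mean; apply/funext => x; exact: play_sum1.
Qed.

Lemma play_le1 A x i : play A x i <= 1.
Proof.
rewrite -(play_sum1 A x) (bigD1 i)//= lerDl.
by apply: sumr_ge0 => j _; exact: play_ge0.
Qed.

Lemma spike01 p q i j : 0 <= p <= 1 -> 0 <= q <= 1 -> 0 <= spike p q i j <= 1.
Proof. by rewrite /spike; case: eqP. Qed.

Lemma spike_instance_Theta p q i : 0 <= p <= 1 -> 0 <= q <= 1 ->
  Theta (spike_instance p q i).
Proof.
move=> p01 q01 j; have s01 := spike01 i j p01 q01.
split; first exact: coin_law_subgaussian.
by rewrite coin_law_mean//; lra.
Qed.

(** Coin means are half the biases. The free arm [j] is a candidate for the best arm, chosen at each
    use. *)
Lemma regret_spike_ge A p q i j : 0 <= p <= 1 -> 0 <= q <= 1 ->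
  (((spike p q i j - p - (q - p) * play_prob A (spike p q i) i) / 2)%:E <=
   regret A (spike_instance p q i))%E.
Proof.
move=> p01 q01; rewrite /regret.
have -> : (fun x => \sum_(l < k) play A x l * mean (spike_instance p q i l)) =
    (fun x => p / 2 + (q - p) / 2 * play A x i).
  apply/funext => x; transitivity
    (\sum_l (p / 2 * play A x l +
             if l == i then (q - p) / 2 * play A x l else 0)).
    apply: eq_bigr => l _; rewrite coin_law_mean; last exact: spike01.
    by rewrite /spike; case: eqP => _; field.
  by rewrite big_split/= -mulr_sumr play_sum1 mulr1 -big_mkcond big_pred1_eq.
have hb : mean (spike_instance p q i j) <= best_mean (spike_instance p q i).
  exact: le_bigmax.
rewrite unlock (integral_tuple_coin_law (p := spike p q i \o obs_arm))/=.
- rewrite coin_mean_affine -/(play_prob A (spike p q i) i) -EFinB lee_fin.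
  by move: hb; rewrite coin_law_mean; [lra|exact: spike01].
- by move=> l; exact: spike01.
- move=> x; have x0 := play_ge0 A x i.
  have x1 := play_le1 A x i.
  nra.
- apply: measurable_funD => //; apply: measurable_funM => //.
  exact: measurable_play.
Qed.

(** Each observation of arm [i] contributes exactly [1 + 4 * e ^+ 2] to the chi-square factor, every
    other one contributes 1. The square on the right is dropped since play probabilities lie in
    [0, 1]. *)
Lemma play_prob_change A p e i : 0 < p < 1 -> - 2^-1 <= e <= 2^-1 ->
  play_prob A (spike p (2^-1 + e) i) i ^+ 2 <=
  expR (4 * e ^+ 2 * (n i)%:R) * play_prob A (spike p 2^-1 i) i.
Proof.
move=> /andP[p0 p1] he.
pose C j : R := if j == i then 1 + 4 * e ^+ 2 else 1.
apply: le_trans (@coin_mean_change _ _ _ (spike p 2^-1 i \o obs_arm)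
   (C \o obs_arm) _ _ _ _) _.
- by move=> l; apply: spike01; lra.
- by move=> l; rewrite /= /spike; case: ifP => _; lra.
- move=> l; rewrite /= /spike /C; case: ifP => _.
    by rewrite le_eqVlt; apply/orP; left; apply/eqP; field.
  rewrite le_eqVlt; apply/orP; left; apply/eqP; field.
  by rewrite !lt0r_neq0// subr_gt0.
have -> : \prod_l C (obs_arm l) = (1 + 4 * e ^+ 2) ^+ n i.
  transitivity (\prod_(u : obs_index n) C (tag u)).
    rewrite [RHS](reindex (@enum_val (obs_index n) predT)) //=.
    exact/onW_bij/enum_val_bij.
  rewrite -(@sig_big_dep _ _ _ _ (fun i => 'I_(n i)) predT (fun _ => predT)
    (fun i _ => C i)) /=.
  rewrite (bigD1 i)//= [X in _ * X]big1 ?mulr1; last first.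
    by move=> j /negbTE ji; rewrite /C ji big1.
  by rewrite /C eqxx prodr_const card_ord.
apply: ler_pM.
- by rewrite exprn_ge0// addr_ge0// mulr_ge0// sqr_ge0.
- rewrite -[leLHS](coin_mean_cst (spike p 2^-1 i \o obs_arm) 0).
  by apply: ler_coin_mean => [l|x]; [apply: spike01; lra|exact: sqr_ge0].
- rewrite expRM_natr lerXn2r ?nnegrE ?expR_ge0 ?expR_ge1Dx//.
  by rewrite addr_ge0// mulr_ge0// sqr_ge0.
- apply: ler_coin_mean => [l|x]; first by apply: spike01; lra.
  by rewrite expr2 ler_piMr ?play_ge0// play_le1.
Qed.
End coin_bandit.

(** * Hard instances against a fixed algorithm *)

Section lower_bounds.
Context {R : realType} (k : nat) (n : 'I_k -> nat).
Implicit Types (A : algorithm (R := R) n) (b : R) (i j : 'I_k).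

Lemma regret_one_unknown_arm A b i j : j != i ->
  0 <= b <= 1 -> b ^+ 2 * (n i)%:R <= 1 ->
  exists2 P, Theta P & ((b / 64)%:E <= regret A P)%E.
Proof.
(* With this scale the change-of-measure exponent is at most 1/4. The means differ by [e / 2], so an
   error probability of 1/4 costs [e / 8 = b / 64]. *)
move=> ji b01 hb; set e := b / 8.
have p01 : 0 <= 2^-1 + e <= 1 by rewrite /e; lra.
have h01 : 0 <= (2^-1 : R) <= 1 by apply/andP; split; lra.
have q01 : 0 <= 2^-1 + 2 * e <= 1 by rewrite /e; lra.
have change : play_prob A (spike (2^-1 + e) (2^-1 + 2 * e) i) i ^+ 2 <=
    4 / 3 * play_prob A (spike (2^-1 + e) 2^-1 i) i.
  apply: le_trans (@play_prob_change _ _ _ A (2^-1 + e) (2 * e) i _ _) _.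
  - by rewrite /e; lra.
  - by rewrite /e; lra.
  apply: ler_wpM2r; first by apply: play_prob_ge0 => l; exact: spike01.
  apply: (@le_trans _ _ (expR 4^-1)).
    rewrite ler_expR.
    have -> : 4 * (2 * e) ^+ 2 * (n i)%:R = 4^-1 * (b ^+ 2 * (n i)%:R).
      by rewrite /e; field.
    lra.
  have -> : 4 / 3 = (1 - 4^-1)^-1 :> R by field.
  by apply: expR_le_inv; lra.
have r0 := regret_spike_ge A i j p01 h01.
have r1 := regret_spike_ge A i i p01 q01.
rewrite /spike (negbTE ji) -/(spike _ _ _) in r0.
rewrite {1}/spike eqxx in r1.
(* Either arm [i] is played too often when it is inferior, or [change] bounds its squared
   probability when it is superior by 1/3, below 9/16. *)
have [x_ge|x_lt] := leP 4^-1 (play_prob A (spike (2^-1 + e) 2^-1 i) i).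
- exists (spike_instance (2^-1 + e) 2^-1 i); first exact: spike_instance_Theta.
  by apply: le_trans r0; rewrite lee_fin; move: x_ge; rewrite /e; nra.
- exists (spike_instance (2^-1 + e) (2^-1 + 2 * e) i).
    exact: spike_instance_Theta.
  apply: le_trans r1; rewrite lee_fin.
  have : play_prob A (spike (2^-1 + e) (2^-1 + 2 * e) i) i <= 3 / 4.
    have : play_prob A (spike (2^-1 + e) (2^-1 + 2 * e) i) i ^+ 2 <= (3 / 4) ^+ 2.
      by apply: (le_trans change); lra.
    by rewrite ler_pXn2r ?nnegrE ?divr_ge0// play_prob_ge0// => l; exact: spike01.
  by rewrite /e; nra.
Qed.

(** Pigeonhole over the arms of index at most [m]; counting from 0, there are [m.+1] of them. *)
Lemma ex_rare_arm A (a : 'I_k -> R) m :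
  (forall j, 0 <= a j <= 1) -> (m < k)%N ->
  exists2 i : 'I_k, (i <= m)%N & play_prob A a i <= m.+1%:R^-1.
Proof.
move=> a01 mk; apply/not_exists2P => h.
have lt1 : \sum_(i < k | (i < m.+1)%N) play_prob A a i <= 1.
  rewrite -(sum_play_prob A a) [leRHS](bigID (fun i : 'I_k => (i < m.+1)%N))/=.
  rewrite lerDl.
  by apply: sumr_ge0 => i _; exact: play_prob_ge0.
move: lt1; rewrite (big_ord_narrow mk)/= leNgt => /negP; apply.
have <- : \sum_(i < m.+1) m.+1%:R^-1 = 1 :> R.
  by rewrite sumr_const card_ord -[LHS]mulr_natr mulVf// pnatr_eq0.
apply: ltr_sum => [|i _].
  by apply/hasP; exists ord0 => //; rewrite mem_index_enum.
rewrite ltNge; apply/negP => hi.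
by case: (h (widen_ord mk i)); apply=> //; have := ltn_ord i; rewrite ltnS.
Qed.

Lemma regret_many_unknown_arms A b (m : 'I_k) :
  (forall i, (i <= m)%N -> (n i <= n m)%N) ->
  0 <= b <= 1 -> 1 <= ln m.+1%:R :> R -> b ^+ 2 * (n m)%:R <= ln m.+1%:R ->
  exists2 P, Theta P & ((b / 64)%:E <= regret A P)%E.
Proof.
move=> nm b01 ln1 hb; set e := b / 8.
have h01 : 0 <= (2^-1 : R) <= 1 by apply/andP; split; lra.
have q01 : 0 <= 2^-1 + e <= 1 by rewrite /e; lra.
have [i im hi] := @ex_rare_arm A (fun=> 2^-1) m (fun=> h01) (ltn_ord m).
exists (spike_instance 2^-1 (2^-1 + e) i); first exact: spike_instance_Theta.
apply: le_trans (regret_spike_ge A i i h01 q01); rewrite lee_fin {1}/spike eqxx.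
have : play_prob A (spike 2^-1 (2^-1 + e) i) i <= 3 / 4.
  have : play_prob A (spike 2^-1 (2^-1 + e) i) i ^+ 2 <= (3 / 4) ^+ 2.
    apply: le_trans (@play_prob_change _ _ _ A 2^-1 e i _ _) _.
    - by lra.
    - by rewrite /e; lra.
    have -> : spike 2^-1 2^-1 i = fun=> 2^-1 :> R.
      by apply/funext => j; rewrite /spike; case: ifP.
    apply: (le_trans (ler_wpM2l (expR_ge0 _) hi)).
    rewrite -[m.+1%:R]lnK ?posrE// -expRN -expRD.
    (* The exponent [4 * e ^+ 2 * n i] is at most 1/16 of [ln m.+1], so the product is at most
       [m.+1] to the power -15/16; then [ln m.+1] is at least 1. The result is at most 16/31, below
       9/16. *)
    apply: (@le_trans _ _ (expR (- (15 / 16)))).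
      rewrite ler_expR.
      have : b ^+ 2 * (n i)%:R <= ln m.+1%:R.
        by apply: le_trans hb; rewrite ler_wpM2l ?sqr_ge0// ler_nat nm.
      by rewrite /e; lra.
    have := @expR_ge1Dx R (15 / 16); rewrite expRN => h.
    apply: (@le_trans _ _ (1 + 15 / 16)^-1).
      by rewrite lef_pV2 ?posrE ?expR_gt0//; lra.
    rewrite (_ : (1 + 15 / 16)^-1 = 16 / 31); last by field.
    lra.
  by rewrite ler_pXn2r ?nnegrE ?divr_ge0// play_prob_ge0// => l; exact: spike01.
by rewrite /e; nra.
Qed.
End lower_bounds.

(** Means in [0, 1] cap the regret at 1 while the maximum over [m] can grow with [k], hence the
    truncation at 1. A single arm has zero regret, hence [1 < k]. *)
Theorem theorem1 (R : realType) :
  exists2 c : R, 0 < c &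
    forall (k : nat) (n : 'I_k -> nat),
      (1 < k)%N ->
      (forall i : 'I_k, (0 < n i)%N) ->
      (forall i j : 'I_k, (i <= j)%N -> (n i <= n j)%N) ->
      ((c * Num.min 1
          (\big[Num.max/0]_(m < k)
             Num.sqrt (Num.max 1 (ln (m.+1)%:R) / (n m)%:R)))%:E
        <= minimax_regret n)%E.
Proof.
exists 64^-1; first by lra.
move=> k n k1 n0 nle; apply: le_ereal_inf_tmp => _ [A _ <-].
pose sup_regret := ereal_sup [set regret A P | P in @Theta R k].
have sup_ge (b : R) :
    (exists2 P : 'I_k -> _, Theta P & ((b / 64)%:E <= regret A P)%E) ->
    ((64^-1 * b)%:E <= sup_regret)%E.
  move=> [P P_Theta]; rewrite mulrC => /le_trans; apply.
  by apply: ereal_sup_ubound; exists P.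
pose i0 := Ordinal (ltnW k1); pose i1 := Ordinal k1.
(* The bound passes to maxima, so one [m] at a time suffices; the initial value 0 is the case
   [b = 0]. *)
elim/big_ind : _ => [|x y hx hy|m _].
- rewrite (_ : Num.min 1 0 = 0 :> R); last by apply/min_idPr.
  apply: sup_ge; apply: (@regret_one_unknown_arm _ _ _ A 0 i0 i1) => //.
    by rewrite lexx ler01.
  by rewrite expr0n/= mul0r ler01.
- by rewrite /Num.max; case: ifP.
(* Truncating at 1 keeps the perturbed biases in [0, 1]. *)
apply: sup_ge; set s := Num.sqrt _; set b := Num.min 1 s.
have b01 : 0 <= b <= 1 by rewrite /b le_min ler01 sqrtr_ge0 ge_min lexx.
have hb : b ^+ 2 * (n m)%:R <= Num.max 1 (ln m.+1%:R).
  have nm0 : 0 < (n m)%:R :> R by rewrite ltr0n.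
  rewrite -ler_pdivlMr//.
  have max0 : 0 <= Num.max 1 (ln m.+1%:R) / (n m)%:R :> R.
    by rewrite divr_ge0// le_max ler01.
  rewrite -[leRHS](sqr_sqrtr max0) ler_pXn2r ?nnegrE ?sqrtr_ge0//.
    by rewrite /b ge_min lexx orbT.
  by case/andP: b01.
have [ln_ge|ln_lt] := leP 1 (ln m.+1%:R : R).
- apply: (@regret_many_unknown_arms _ _ _ A b m) => //.
    by move=> i; exact: nle.
  by move: hb; rewrite max_r.
(* The unknown arm [i0] has the smallest count, so [b ^+ 2 * n i0] is at most [b ^+ 2 * n m], hence
   at most 1. *)
- apply: (@regret_one_unknown_arm _ _ _ A b i0 i1) => //.
  apply: (@le_trans _ _ (b ^+ 2 * (n m)%:R)).
    by rewrite ler_wpM2l ?sqr_ge0// ler_nat nle.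
  by move: hb; rewrite max_l// ltW.
Qed.
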